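(* (Noether's second isomorphism theorem.) Let $\mathcal A$ be an ideally exact category. Then, for any pair of normal spans $H_1$ and $H_2$ over an object $A$ of $\mathcal A$, the following hold. 1. The meet $H_1\wedge H_2$ and the join $H_1\vee H_2$ of $H_1$ and $H_2$ in the partially ordered set of normal spans over $A$ exist. 2. $H_1\wedge H_2$ is a normal span over $H_1$, over $H_2$ and over $H_1\vee H_2$. 3. $H_1$ and $H_2$ are normal spans over $H_1\vee H_2$. 4. There is an isomorphism $$\frac{H_1}{H_1\wedge H_2}\cong\frac{H_1\vee H_2}{H_2}.$$
   Context: An ideally exact category is a Barr-exact category with finite coproducts admitting a monadic functor to a semi-abelian category. In a category with an initial object $0$, the kernel of $f\colon A\to B$ is the span $(H,e\colon H\to0,h\colon H\to A)$ given by the pullback of $f$ along the unique morphism $0\to B$. A normal span over $A$ is a span $(H,e\colon H\to 0,h\colon H\to A)$ that is the kernel of some morphism with domain $A$; it is often denoted just by $H$. For normal spans over $A$, write $(H,e,h)\le(H',e',h')$ if there is a (necessarily unique) morphism $\eta\colon H\to H'$ with $e'\circ\eta=e$ and $h'\circ\eta=h$. This is a preorder; identifying $H$ and $H'$ whenever $H\le H'$ and $H'\le H$ gives the poset of normal spans over $A$. If $(H,e,h)\le (H',e',h')$ are normal spans over $A$ via $\eta\colon H\to H'$, then saying that $H$ is a normal span over $H'$ means that $(H,e\colon H\to0,\eta\colon H\to H')$ is a normal span over the object $H'$. For a normal span $(H,e,h)$ over an object $X$, $X/H$ denotes the pushout of $e$ along $h$ (it exists in an ideally exact category, and $(H,e,h)$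 is the kernel of the resulting morphism $X\to X/H$). *)

(* Defs.v *)
From Stdlib Require Import ProofIrrelevance.

Set Implicit Arguments.
Unset Strict Implicit.

(** * Categories, functors, natural transformations *)

Record Category : Type := {
  Obj :> Type;
  Hom : Obj -> Obj -> Type;
  idc : forall X : Obj, Hom X X;
  comp : forall X Y W : Obj, Hom Y W -> Hom X Y -> Hom X W;
  comp_idl : forall (X Y : Obj) (f : Hom X Y), comp (idc Y) f = f;
  comp_idr : forall (X Y : Obj) (f : Hom X Y), comp f (idc X) = f;
  comp_assoc : forall (X Y W V : Obj)
      (h : Hom W V) (g : Hom Y W) (f : Hom X Y),
    comp h (comp g f) = comp (comp h g) f
}.

Arguments Hom {c} _ _.
Arguments idc {c} X.
Arguments comp {c X Y W} _ _.

Declare Scope cat_scope.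
Open Scope cat_scope.
Notation "g ∘ f" := (comp g f) (at level 40, left associativity) : cat_scope.

Record Functor (C D : Category) : Type := {
  fobj :> C -> D;
  fmap : forall X Y : C, Hom X Y -> Hom (fobj X) (fobj Y);
  fmap_id : forall X : C, fmap (idc X) = idc (fobj X);
  fmap_comp : forall (X Y W : C) (g : Hom Y W) (f : Hom X Y),
    fmap (g ∘ f) = fmap g ∘ fmap f
}.

Arguments fmap {C D} _ {X Y} _.

Definition id_functor (C : Category) : Functor C C :=
  {| fobj := fun X => X;
     fmap := fun X Y f => f;
     fmap_id := fun X => eq_refl;
     fmap_comp := fun X Y W g f => eq_refl |}.

Definition comp_functor (C D E : Category) (G : Functor D E) (F : Functor C D) :
  Functor C E.
Proof.
refine {| fobj := fun X => G (F X);
          fmap := fun X Y f => fmap G (fmap F f) |}.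
- intros X; rewrite fmap_id; apply fmap_id.
- intros X Y W g f; rewrite fmap_comp; apply fmap_comp.
Defined.

Record NatTrans (C D : Category) (F G : Functor C D) : Type := {
  component :> forall X : C, Hom (F X) (G X);
  naturality : forall (X Y : C) (f : Hom X Y),
    fmap G f ∘ component X = component Y ∘ fmap F f
}.

Definition is_iso (C : Category) (X Y : C) (f : Hom X Y) : Prop :=
  exists g : Hom Y X, g ∘ f = idc X /\ f ∘ g = idc Y.

Definition isomorphic (C : Category) (X Y : C) : Prop :=
  exists f : Hom X Y, is_iso f.

Definition nat_isomorphic (C D : Category) (F G : Functor C D) : Prop :=
  exists t : NatTrans F G, forall X : C, is_iso (t X).

Definition is_equivalence (C D : Category) (F : Functor C D) : Prop :=
  exists G : Functor D C,
    nat_isomorphic (comp_functor G F) (id_functor C) /\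
    nat_isomorphic (comp_functor F G) (id_functor D).

(** * Adjunctions, monads, monadic functors *)

Record Adjunction (C D : Category) (F : Functor C D) (U : Functor D C) : Type := {
  unit : NatTrans (id_functor C) (comp_functor U F);
  counit : NatTrans (comp_functor F U) (id_functor D);
  triangle_left : forall X : C, counit (F X) ∘ fmap F (unit X) = idc (F X);
  triangle_right : forall Y : D, fmap U (counit Y) ∘ unit (U Y) = idc (U Y)
}.

Record Monad (C : Category) : Type := {
  mfun :> Functor C C;
  ret : NatTrans (id_functor C) mfun;
  mult : NatTrans (comp_functor mfun mfun) mfun;
  mult_retl : forall X : C, mult X ∘ ret (mfun X) = idc (mfun X);
  mult_retr : forall X : C, mult X ∘ fmap mfun (ret X) = idc (mfun X);
  mult_assoc : forall X : C,
    mult X ∘ fmap mfun (mult X) = mult X ∘ mult (mfun X)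
}.

Definition adjunction_mult (C D : Category) (F : Functor C D) (U : Functor D C)
    (adj : Adjunction F U) :
  NatTrans (comp_functor (comp_functor U F) (comp_functor U F))
           (comp_functor U F).
Proof.
refine {| component := fun X : C =>
            fmap U (counit adj (F X))
            : Hom (comp_functor (comp_functor U F) (comp_functor U F) X)
                  (comp_functor U F X) |}.
intros X Y f; simpl.
rewrite <- !fmap_comp; f_equal; exact (naturality (counit adj) (fmap F f)).
Defined.

Definition adjunction_monad (C D : Category) (F : Functor C D) (U : Functor D C)
    (adj : Adjunction F U) : Monad C.
Proof.
refine {| mfun := comp_functor U F;
          ret := unit adj;
          mult := adjunction_mult adj |}.
- intros X; exact (triangle_right adj (F X)).
- intros X; simpl; rewrite <- fmap_comp.
  exact (eq_trans (f_equal (fmap U) (triangle_left adj X)) (fmap_id U (F X))).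
- intros X; simpl; rewrite <- !fmap_comp; f_equal.
  symmetry; exact (naturality (counit adj) (counit adj (F X))).
Defined.

Record Algebra (C : Category) (T : Monad C) : Type := {
  carrier :> C;
  action : Hom (T carrier) carrier;
  action_ret : action ∘ ret T carrier = idc carrier;
  action_mult : action ∘ fmap T action = action ∘ mult T carrier
}.

Record AlgebraHom (C : Category) (T : Monad C) (X Y : Algebra T) : Type := {
  alg_map :> Hom (carrier X) (carrier Y);
  alg_map_action : alg_map ∘ action X = action Y ∘ fmap T alg_map
}.

Lemma AlgebraHom_eq (C : Category) (T : Monad C) (X Y : Algebra T)
    (f g : AlgebraHom X Y) : alg_map f = alg_map g -> f = g.
Proof.
destruct f as [f Hf], g as [g Hg]; simpl; intros E; subst g.
f_equal; apply proof_irrelevance.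
Qed.

Definition alg_id (C : Category) (T : Monad C) (X : Algebra T) : AlgebraHom X X.
Proof.
refine {| alg_map := idc (carrier X) |}.
rewrite fmap_id, comp_idl, comp_idr; reflexivity.
Defined.

Definition alg_comp (C : Category) (T : Monad C) (X Y W : Algebra T)
    (g : AlgebraHom Y W) (f : AlgebraHom X Y) : AlgebraHom X W.
Proof.
refine {| alg_map := alg_map g ∘ alg_map f |}.
rewrite fmap_comp, <- comp_assoc, alg_map_action, !comp_assoc, alg_map_action.
reflexivity.
Defined.

Definition EilenbergMoore (C : Category) (T : Monad C) : Category.
Proof.
refine {| Obj := Algebra T;
          Hom := @AlgebraHom C T;
          idc := @alg_id C T;
          comp := @alg_comp C T |}.
- intros; apply AlgebraHom_eq, comp_idl.
- intros; apply AlgebraHom_eq, comp_idr.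
- intros; apply AlgebraHom_eq, comp_assoc.
Defined.

Definition comparison_obj (C D : Category) (F : Functor C D) (U : Functor D C)
    (adj : Adjunction F U) (Y : D) : Algebra (adjunction_monad adj).
Proof.
refine {| carrier := U Y;
          action := fmap U (counit adj Y)
                    : Hom (adjunction_monad adj (U Y)) (U Y) |}.
- exact (triangle_right adj Y).
- simpl; rewrite <- !fmap_comp; f_equal.
  symmetry; exact (naturality (counit adj) (counit adj Y)).
Defined.

Definition comparison_map (C D : Category) (F : Functor C D) (U : Functor D C)
    (adj : Adjunction F U) (X Y : D) (f : Hom X Y) :
  AlgebraHom (comparison_obj adj X) (comparison_obj adj Y).
Proof.
refine {| alg_map := fmap U f
            : Hom (carrier (comparison_obj adj X))
                  (carrier (comparison_obj adj Y)) |}.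
simpl; rewrite <- !fmap_comp; f_equal; exact (naturality (counit adj) f).
Defined.

Definition comparison (C D : Category) (F : Functor C D) (U : Functor D C)
    (adj : Adjunction F U) :
  Functor D (EilenbergMoore (adjunction_monad adj)).
Proof.
refine {| fobj := comparison_obj adj
            : D -> EilenbergMoore (adjunction_monad adj);
          fmap := fun X Y f => comparison_map adj f |}.
- intros X; apply AlgebraHom_eq; simpl; apply fmap_id.
- intros X Y W g f; apply AlgebraHom_eq; simpl; apply fmap_comp.
Defined.

Definition monadic (C D : Category) (U : Functor D C) : Prop :=
  exists (F : Functor C D) (adj : Adjunction F U),
    is_equivalence (comparison adj).

(** * Limits and colimits *)

Section Limits.
Variable C : Category.

Definition is_initial (Z : C) : Prop := forall X : C, exists! f : Hom Z X, True.

Definition is_terminal (I : C) : Prop := forall X : C, exists! f : Hom X I, True.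

Definition is_zero_object (Z : C) : Prop := is_initial Z /\ is_terminal Z.

Definition is_coproduct (X Y S : C) (i : Hom X S) (j : Hom Y S) : Prop :=
  forall (W : C) (f : Hom X W) (g : Hom Y W),
    exists! u : Hom S W, u ∘ i = f /\ u ∘ j = g.

(* The square  f ∘ p = g ∘ q  is a pullback of f and g. *)
Definition is_pullback (X Y B P : C) (f : Hom X B) (g : Hom Y B)
    (p : Hom P X) (q : Hom P Y) : Prop :=
  f ∘ p = g ∘ q /\
  forall (W : C) (a : Hom W X) (b : Hom W Y), f ∘ a = g ∘ b ->
    exists! u : Hom W P, p ∘ u = a /\ q ∘ u = b.

(* The square  p ∘ f = q ∘ g  is a pushout of f and g. *)
Definition is_pushout (X Y B P : C) (f : Hom B X) (g : Hom B Y)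
    (p : Hom X P) (q : Hom Y P) : Prop :=
  p ∘ f = q ∘ g /\
  forall (W : C) (a : Hom X W) (b : Hom Y W), a ∘ f = b ∘ g ->
    exists! u : Hom P W, u ∘ p = a /\ u ∘ q = b.

Definition is_coequalizer (X Y Q : C) (f g : Hom X Y) (q : Hom Y Q) : Prop :=
  q ∘ f = q ∘ g /\
  forall (W : C) (a : Hom Y W), a ∘ f = a ∘ g -> exists! u : Hom Q W, u ∘ q = a.

Definition is_kernel_pair (X Y R : C) (f : Hom X Y) (r1 r2 : Hom R X) : Prop :=
  is_pullback f f r1 r2.

Definition is_regular_epi (Y Q : C) (q : Hom Y Q) : Prop :=
  exists (X : C) (f g : Hom X Y), is_coequalizer f g q.

Definition has_pullbacks : Prop :=
  forall (X Y B : C) (f : Hom X B) (g : Hom Y B),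
    exists (P : C) (p : Hom P X) (q : Hom P Y), is_pullback f g p q.

Definition finitely_complete : Prop :=
  (exists I : C, is_terminal I) /\ has_pullbacks.

Definition has_finite_coproducts : Prop :=
  (exists Z : C, is_initial Z) /\
  forall X Y : C,
    exists (S : C) (i : Hom X S) (j : Hom Y S), is_coproduct i j.

End Limits.

(** * Barr-exact, protomodular, semi-abelian and ideally exact categories *)

Definition is_regular_category (C : Category) : Prop :=
  finitely_complete C /\
  (forall (X Y R : C) (f : Hom X Y) (r1 r2 : Hom R X),
     is_kernel_pair f r1 r2 ->
     exists (Q : C) (q : Hom X Q), is_coequalizer r1 r2 q) /\
  (forall (X Y B P : C) (f : Hom X B) (g : Hom Y B) (p : Hom P X) (q : Hom P Y),
     is_pullback f g p q -> is_regular_epi f -> is_regular_epi q).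

Definition is_equivalence_relation (C : Category) (X R : C) (r1 r2 : Hom R X) :
    Prop :=
  (forall (W : C) (a b : Hom W R), r1 ∘ a = r1 ∘ b -> r2 ∘ a = r2 ∘ b -> a = b) /\
  (exists d : Hom X R, r1 ∘ d = idc X /\ r2 ∘ d = idc X) /\
  (exists s : Hom R R, r1 ∘ s = r2 /\ r2 ∘ s = r1) /\
  (forall (P : C) (p1 p2 : Hom P R), is_pullback r2 r1 p1 p2 ->
     exists t : Hom P R, r1 ∘ t = r1 ∘ p1 /\ r2 ∘ t = r2 ∘ p2).

Definition is_Barr_exact (C : Category) : Prop :=
  is_regular_category C /\
  forall (X R : C) (r1 r2 : Hom R X), is_equivalence_relation r1 r2 ->
    exists (Y : C) (f : Hom X Y), is_kernel_pair f r1 r2.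

(* Bourn protomodularity: pullbacks exist and, for each p : E -> B, the
   change-of-base functor p^* : Pt(B) -> Pt(E) between categories of points
   (split epimorphisms with a chosen section) reflects isomorphisms.
   Here (xE, sE) = p^*(x, s), (yE, tE) = p^*(y, t) and gE = p^*(g) are
   computed with arbitrary pullbacks rather than chosen ones. *)
Definition is_protomodular (C : Category) : Prop :=
  has_pullbacks C /\
  forall (E B : C) (p : Hom E B)
    (X : C) (x : Hom X B) (s : Hom B X) (Y : C) (y : Hom Y B) (t : Hom B Y)
    (g : Hom X Y)
    (XE : C) (pX : Hom XE X) (xE : Hom XE E) (sE : Hom E XE)
    (YE : C) (pY : Hom YE Y) (yE : Hom YE E) (tE : Hom E YE)
    (gE : Hom XE YE),
    x ∘ s = idc B -> y ∘ t = idc B -> y ∘ g = x -> g ∘ s = t ->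
    is_pullback x p pX xE -> pX ∘ sE = s ∘ p -> xE ∘ sE = idc E ->
    is_pullback y p pY yE -> pY ∘ tE = t ∘ p -> yE ∘ tE = idc E ->
    pY ∘ gE = g ∘ pX -> yE ∘ gE = xE ->
    is_iso gE -> is_iso g.

Definition is_semi_abelian (C : Category) : Prop :=
  (exists Z : C, is_zero_object Z) /\
  is_Barr_exact C /\ is_protomodular C /\ has_finite_coproducts C.

Definition is_ideally_exact (A : Category) : Prop :=
  is_Barr_exact A /\ has_finite_coproducts A /\
  exists (V : Category) (U : Functor A V), is_semi_abelian V /\ monadic U.

(** * Normal spans *)

Section NormalSpans.
Variables (A : Category) (O : A).

(* O plays the role of the initial object 0. *)
Record Span (X : A) : Type := {
  apex : A;
  span_e : Hom apex O;
  span_h : Hom apex X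
}.

Definition is_kernel (X B : A) (f : Hom X B) (H : Span X) : Prop :=
  exists i : Hom O B, is_pullback f i (span_h H) (span_e H).

Definition is_normal (X : A) (H : Span X) : Prop :=
  exists (B : A) (f : Hom X B), is_kernel f H.

Definition le_via (X : A) (H H' : Span X) (eta : Hom (apex H) (apex H')) : Prop :=
  span_e H' ∘ eta = span_e H /\ span_h H' ∘ eta = span_h H.

Definition span_le (X : A) (H H' : Span X) : Prop :=
  exists eta : Hom (apex H) (apex H'), le_via eta.

(* Meets and joins in the poset of normal spans are given by greatest lower
   and least upper bounds in the preorder, determined up to the identification
   of H and H' when span_le H H' and span_le H' H. *)
Definition is_meet (X : A) (H1 H2 M : Span X) : Prop :=
  is_normal M /\ span_le M H1 /\ span_le M H2 /\
  forall H : Span X, is_normal H -> span_le H H1 -> span_le H H2 -> span_le H M.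

Definition is_join (X : A) (H1 H2 J : Span X) : Prop :=
  is_normal J /\ span_le H1 J /\ span_le H2 J /\
  forall H : Span X, is_normal H -> span_le H1 H -> span_le H2 H -> span_le J H.

Definition span_over (X : A) (H H' : Span X) (eta : Hom (apex H) (apex H')) :
    Span (apex H') :=
  {| apex := apex H; span_e := span_e H; span_h := eta |}.

Definition is_normal_over (X : A) (H H' : Span X) : Prop :=
  exists eta : Hom (apex H) (apex H'),
    le_via eta /\ is_normal (span_over eta).

Definition is_quotient (X : A) (H : Span X) (Q : A) : Prop :=
  exists (z : Hom O Q) (q : Hom X Q), is_pushout (span_e H) (span_h H) z q.

End NormalSpans.

(* Main.v *)
(** A monadic functor to a semi-abelian category preserves pullbacks and reflects
    isomorphisms, so an ideally exact category is protomodular.  Applied to the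
    points given by kernel pairs and to the map [O -> X], protomodularity shows
    that the kernel span of [f] determines which morphisms factor through a regular
    epimorphism [f]; hence meets are kernels of pairings and quotients by kernels
    of regular epimorphisms are their codomains.

    Let [H1], [H2] be the kernels of regular epimorphisms [f1], [f2], and let [T] be
    the image under [f2] of the kernel pair of [f1].  Protomodularity again shows
    that pairs in [T] lift along [f2] with a prescribed first component.  Therefore
    [T] is an equivalence relation, the kernel of [X -> B2 -> B2/T] is the join, and
    [H1 -> ker (B2 -> B2/T)] is a regular epimorphism with kernel the meet.  As
    [H1 \/ H2 -> ker (B2 -> B2/T)] is a regular epimorphism with kernel [H2], both
    quotients are [ker (B2 -> B2/T)]. *)

Require Import Defs.

Set Implicit Arguments.
Unset Strict Implicit.

(** * Rewriting inside right-nested composites *)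

Lemma comp_eq_r (C : Category) (X Y Z W : C) (f : Hom Y Z) (g : Hom X Y)
    (h : Hom X Z) (E : f ∘ g = h) (k : Hom W X) : f ∘ (g ∘ k) = h ∘ k.
Proof. rewrite comp_assoc, E; reflexivity. Qed.

Lemma comp_eq_rr (C : Category) (X Y Y' Z W : C) (f : Hom Y Z) (g : Hom X Y)
    (f' : Hom Y' Z) (g' : Hom X Y') (E : f ∘ g = f' ∘ g') (k : Hom W X) :
  f ∘ (g ∘ k) = f' ∘ (g' ∘ k).
Proof. rewrite !comp_assoc, E; reflexivity. Qed.

(** Composites are kept nested to the right, where [f ∘ g] is not a subterm of [f ∘ (g ∘ k)]; hence
    the versions of [E] with a trailing factor are tried first. *)
Ltac crw E :=
  rewrite <- ?comp_assoc;
  first [rewrite (comp_eq_rr E) | rewrite (comp_eq_r E) | rewrite E];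
  rewrite <- ?comp_assoc, ?comp_idl, ?comp_idr.

Ltac crwr E := crw (eq_sym E).

(** * Pullbacks, monomorphisms and regular epimorphisms in general categories *)

Section Pullbacks.
Variable C : Category.

Definition monic (X Y : C) (m : Hom X Y) : Prop :=
  forall (W : C) (a b : Hom W X), m ∘ a = m ∘ b -> a = b.

Definition jointly_monic (X Y P : C) (p : Hom P X) (q : Hom P Y) : Prop :=
  forall (W : C) (a b : Hom W P), p ∘ a = p ∘ b -> q ∘ a = q ∘ b -> a = b.

Lemma initial_eq (O : C) (hO : is_initial O) (Y : C) (a b : Hom O Y) : a = b.
Proof.
destruct (hO Y) as [c [_ Hc]].
transitivity c; [symmetry|]; apply Hc; exact I.
Qed.

Lemma terminal_eq (T : C) (hT : is_terminal T) (Y : C) (a b : Hom Y T) : a = b.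
Proof.
destruct (hT Y) as [c [_ Hc]].
transitivity c; [symmetry|]; apply Hc; exact I.
Qed.

Lemma pullback_intro (X Y B P : C) (f : Hom X B) (g : Hom Y B)
    (p : Hom P X) (q : Hom P Y) :
  f ∘ p = g ∘ q -> jointly_monic p q ->
  (forall (W : C) (a : Hom W X) (b : Hom W Y), f ∘ a = g ∘ b ->
     exists u : Hom W P, p ∘ u = a /\ q ∘ u = b) ->
  is_pullback f g p q.
Proof.
intros E Hm Hl; split; [exact E|].
intros W a b Eab; destruct (Hl W a b Eab) as [u [Eu1 Eu2]].
exists u; split; [split; assumption|].
intros v [Ev1 Ev2]; apply Hm; congruence.
Qed.

Lemma pullback_lift (X Y B P : C) (f : Hom X B) (g : Hom Y B)
    (p : Hom P X) (q : Hom P Y) (Hp : is_pullback f g p q)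
    (W : C) (a : Hom W X) (b : Hom W Y) :
  f ∘ a = g ∘ b -> exists u : Hom W P, p ∘ u = a /\ q ∘ u = b.
Proof.
intros E; destruct (proj2 Hp W a b E) as [u [Hu _]]; exists u; exact Hu.
Qed.

Lemma pullback_jointly_monic (X Y B P : C) (f : Hom X B) (g : Hom Y B)
    (p : Hom P X) (q : Hom P Y) : is_pullback f g p q -> jointly_monic p q.
Proof.
intros [E Hp] W a b E1 E2.
assert (Eab : f ∘ (p ∘ a) = g ∘ (q ∘ a)) by (crw E; reflexivity).
destruct (Hp W (p ∘ a) (q ∘ a) Eab) as [u [_ Hu]].
transitivity u; [symmetry|]; apply Hu; split; auto.
Qed.

Lemma pullback_sym (X Y B P : C) (f : Hom X B) (g : Hom Y B)
    (p : Hom P X) (q : Hom P Y) : is_pullback f g p q -> is_pullback g f q p.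
Proof.
intros Hp; apply pullback_intro.
- symmetry; exact (proj1 Hp).
- intros W a b E1 E2; exact (pullback_jointly_monic Hp E2 E1).
- intros W a b E.
  destruct (pullback_lift Hp (eq_sym E)) as [u [E1 E2]]; exists u; auto.
Qed.

Lemma kernel_pair_diagonal (X B R : C) (f : Hom X B) (r1 r2 : Hom R X) :
  is_kernel_pair f r1 r2 ->
  exists d : Hom X R, r1 ∘ d = idc X /\ r2 ∘ d = idc X.
Proof. intros H; exact (pullback_lift H (eq_refl (f ∘ idc X))). Qed.

Lemma monic_split_epi_iso (X Y : C) (m : Hom X Y) (s : Hom Y X) :
  monic m -> m ∘ s = idc Y -> is_iso m.
Proof.
intros Hm E; exists s; split; [|exact E].
apply Hm; crw E; reflexivity.
Qed.

Lemma binary_products (hC : finitely_complete C) (X Y : C) :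
  exists (P : C) (p : Hom P X) (q : Hom P Y), jointly_monic p q /\
    forall (W : C) (a : Hom W X) (b : Hom W Y),
      exists u : Hom W P, p ∘ u = a /\ q ∘ u = b.
Proof.
destruct hC as [[T hT] hpb].
destruct (hT X) as [x _], (hT Y) as [y _].
destruct (hpb X Y T x y) as [P [p [q Hp]]].
exists P, p, q; split; [exact (pullback_jointly_monic Hp)|].
intros W a b; apply (pullback_lift Hp), (terminal_eq hT).
Qed.

Lemma regular_epi_epi (X Y : C) (q : Hom X Y) : is_regular_epi q ->
  forall (W : C) (a b : Hom Y W), a ∘ q = b ∘ q -> a = b.
Proof.
intros [Z [f [g [E Hq]]]] W a b Eab.
destruct (Hq W (a ∘ q)) as [u [_ Hu]].
- crw E; reflexivity.
- transitivity u; [symmetry|]; apply Hu; auto.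
Qed.

Lemma regular_epi_factor (X Y W : C) (q : Hom X Y) (g : Hom X W) :
  is_regular_epi q ->
  (forall (V : C) (a b : Hom V X), q ∘ a = q ∘ b -> g ∘ a = g ∘ b) ->
  exists u : Hom Y W, u ∘ q = g.
Proof.
intros [Z [a [b [E Hq]]]] Hg.
destruct (Hq W g (Hg Z a b E)) as [u [Hu _]]; exists u; exact Hu.
Qed.

Lemma regular_epi_iso (X Y Z : C) (q : Hom X Y) (m : Hom Y Z) :
  is_regular_epi q -> is_iso m -> is_regular_epi (m ∘ q).
Proof.
intros [V [a [b [E Hq]]]] [n [E1 E2]]; exists V, a, b; split.
- crw E; reflexivity.
- intros W c Ec; destruct (Hq W c Ec) as [u [Eu Hu]].
  exists (u ∘ n); split.
  + crw (comp_eq_r E1 q); exact Eu.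
  + intros v Ev; rewrite (Hu (v ∘ m)).
    * crw E2; reflexivity.
    * rewrite <- comp_assoc; exact Ev.
Qed.

End Pullbacks.

(** * Images and regular epimorphisms in a regular category *)

Section RegularCategory.
Variable C : Category.
Hypothesis hC : is_regular_category C.

Lemma regular_epi_pullback (X Y B P : C) (f : Hom X B) (g : Hom Y B)
    (p : Hom P X) (q : Hom P Y) :
  is_pullback f g p q -> is_regular_epi f -> is_regular_epi q.
Proof. exact (proj2 (proj2 hC) X Y B P f g p q). Qed.

Lemma lift_along_regular_epi (X B W : C) (f : Hom X B) (g : Hom W B) :
  is_regular_epi f -> exists (V : C) (w : Hom V W) (a : Hom V X),
    is_regular_epi w /\ f ∘ a = g ∘ w.
Proof.
intros Hf; destruct (proj2 (proj1 hC) X W B f g) as [V [a [w Hp]]].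
exists V, w, a; split; [exact (regular_epi_pullback Hp Hf) | exact (proj1 Hp)].
Qed.

(** [q] is the coequalizer of the kernel pair of [f]. For monicity of [m], [a] and [b] are lifted
    along [q] after passing to regular epimorphic covers; [f] identifies the lifts, so they form a
    pair in [R], which [q] collapses. *)
Lemma image_factorization (X Y : C) (f : Hom X Y) :
  exists (Q : C) (q : Hom X Q) (m : Hom Q Y),
    is_regular_epi q /\ monic m /\ m ∘ q = f.
Proof.
destruct (proj2 (proj1 hC) X X Y f f) as [R [r1 [r2 HR]]].
destruct (proj1 (proj2 hC) X Y R f r1 r2 HR) as [Q [q Hq]].
assert (Rq : is_regular_epi q) by (exists R, r1, r2; exact Hq).
destruct (proj2 Hq Y f (proj1 HR)) as [m [Em _]].
exists Q, q, m; split; [exact Rq|split; [|exact Em]].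
intros W a b Eab.
destruct (lift_along_regular_epi a Rq) as [V [w [a' [Rw Ea]]]].
destruct (lift_along_regular_epi (b ∘ w) Rq) as [V' [w' [b' [Rw' Eb]]]].
apply (regular_epi_epi Rw), (regular_epi_epi Rw').
assert (E : f ∘ (a' ∘ w') = f ∘ b').
{ rewrite <- Em; crw Eb; crw (comp_eq_r Ea w').
  rewrite !comp_assoc, Eab; reflexivity. }
destruct (pullback_lift HR E) as [c [E1 E2]].
rewrite <- (comp_assoc b), <- Ea, <- !comp_assoc in *.
rewrite <- Eb, <- E1, <- E2; crw (proj1 Hq); reflexivity.
Qed.

(** As [m] is monic, [k] identifies whatever [q] does, and so descends along [q] to a section of
    [m]. *)
Lemma regular_epi_monic_iso (X Y Z : C) (q : Hom X Z) (k : Hom X Y)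
    (m : Hom Y Z) :
  is_regular_epi q -> monic m -> m ∘ k = q -> is_iso m.
Proof.
intros Rq Hm E.
destruct (@regular_epi_factor C X Z Y q k Rq) as [u Eu].
{ intros V a b Eab; apply Hm; rewrite !comp_assoc, E; exact Eab. }
apply (@monic_split_epi_iso C Y Z m u Hm), (regular_epi_epi Rq).
crw Eu; exact E.
Qed.

Lemma regular_epi_extremal (X Y : C) (f : Hom X Y) :
  (forall (I : C) (k : Hom X I) (m : Hom I Y), monic m -> m ∘ k = f -> is_iso m) ->
  is_regular_epi f.
Proof.
intros H; destruct (image_factorization f) as [Q [q [m [Rq [Hm E]]]]].
rewrite <- E; exact (regular_epi_iso Rq (H Q q m Hm E)).
Qed.

Lemma regular_epi_cancel (X Y Z : C) (f : Hom X Y) (g : Hom Y Z) :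
  is_regular_epi (g ∘ f) -> is_regular_epi g.
Proof.
intros H; apply regular_epi_extremal; intros I k m Hm E.
apply (@regular_epi_monic_iso X I Z (g ∘ f) (k ∘ f) m H Hm).
crw E; reflexivity.
Qed.

(** Pulling the monic [m] back along [g] gives a monic [n] through which [f] factors; [n] is then
    invertible, so [g] itself factors through [m]. *)
Lemma regular_epi_comp (X Y Z : C) (f : Hom X Y) (g : Hom Y Z) :
  is_regular_epi f -> is_regular_epi g -> is_regular_epi (g ∘ f).
Proof.
intros Rf Rg; apply regular_epi_extremal; intros I k m Hm E.
destruct (proj2 (proj1 hC) I Y Z m g) as [P [p [n Hp]]].
destruct (pullback_lift Hp E) as [l [E1 E2]].
assert (Hn : monic n).
{ intros W a b Eab; apply (pullback_jointly_monic Hp); [|exact Eab].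
  apply Hm; crw (proj1 Hp); crw (proj1 Hp); rewrite Eab; reflexivity. }
destruct (regular_epi_monic_iso Rf Hn E2) as [s [_ Es]].
apply (@regular_epi_monic_iso Y I Z g (p ∘ s) m Rg Hm).
crw (proj1 Hp); crw Es; reflexivity.
Qed.

End RegularCategory.

(** * Protomodularity over the initial object: kernels control kernel pairs *)

Section Protomodular.
Variables (C : Category) (O : C).
Hypotheses (hO : is_initial O) (hC : is_regular_category C)
  (hP : is_protomodular C).

Lemma initial_map (Y : C) : exists o : Hom O Y, True.
Proof. destruct (hO Y) as [o _]; exists o; exact I. Qed.

(* Protomodularity along [O -> B]: sections of the fibres need not be tracked,
   since morphisms out of [O] are unique. *)
Lemma point_iso (B X Y F : C) (x : Hom X B) (s : Hom B X) (y : Hom Y B)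
    (g : Hom X Y) (o : Hom O B) (k : Hom F X) (c : Hom F O) :
  x ∘ s = idc B -> y ∘ g = x ->
  is_pullback x o k c -> is_pullback y o (g ∘ k) c -> is_iso g.
Proof.
intros Es Eg Hx Hy.
destruct (initial_map F) as [z _].
(* Both pullbacks along [o] share the apex [F], so the map between the fibres is the identity; the
   section of [y] is [g ∘ s]. *)
apply (proj2 hP O B o X x s Y y (g ∘ s) g F k c z F (g ∘ k) c z (idc F));
  try assumption; try apply (initial_eq hO); try reflexivity.
- crw Eg; exact Es.
- rewrite comp_idr; reflexivity.
- apply comp_idr.
- exists (idc F); split; apply comp_idl.
Qed.

(** A pair in [R] whose first component factors through [o] is determined by its second component,
    which lies in the kernel. The fibre of the point [r1] is thus the kernel span, which makes
    [point_iso] applicable to kernel pairs. *)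
Lemma kernel_pair_fibre (X B R H : C) (f : Hom X B) (i : Hom O B)
    (h : Hom H X) (e : Hom H O) (r1 r2 : Hom R X) (o : Hom O X) (k : Hom H R) :
  is_pullback f i h e -> is_kernel_pair f r1 r2 ->
  r1 ∘ k = o ∘ e -> r2 ∘ k = h -> is_pullback r1 o k e.
Proof.
intros HH HR E1 E2; apply pullback_intro; [exact E1| |].
- intros W a b Ea Eb; apply (pullback_jointly_monic HH); [|exact Eb].
  rewrite <- E2, <- !comp_assoc, Ea; reflexivity.
- intros W a b Eab.
  assert (E : f ∘ (r2 ∘ a) = i ∘ b).
  { crwr (proj1 HR); rewrite Eab; rewrite comp_assoc.
    f_equal; apply (initial_eq hO). }
  destruct (pullback_lift HH E) as [u [Eu1 Eu2]].
  exists u; split; [|exact Eu2].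
  apply (pullback_jointly_monic HR).
  + crw E1; rewrite Eu2; symmetry; exact Eab.
  + crw E2; exact Eu1.
Qed.

Lemma kernel_pair_fibre_exists (X B R H : C) (f : Hom X B) (i : Hom O B)
    (h : Hom H X) (e : Hom H O) (r1 r2 : Hom R X) (o : Hom O X) :
  is_pullback f i h e -> is_kernel_pair f r1 r2 ->
  exists k : Hom H R, r1 ∘ k = o ∘ e /\ r2 ∘ k = h.
Proof.
intros HH HR; apply (pullback_lift HR).
rewrite (proj1 HH), comp_assoc; f_equal; apply (initial_eq hO).
Qed.

(** The pairing of [f] and [g] has the same kernel as [f]. Its kernel pair [T] therefore maps to the
    kernel pair [R] of [f] by a morphism of points that is invertible on fibres over [O], hence
    invertible. *)
Lemma coequalizes_of_kernel (X B D H : C) (f : Hom X B) (g : Hom X D)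
    (i : Hom O B) (j : Hom O D) (h : Hom H X) (e : Hom H O) :
  is_pullback f i h e -> g ∘ h = j ∘ e ->
  forall (W : C) (a b : Hom W X), f ∘ a = f ∘ b -> g ∘ a = g ∘ b.
Proof.
intros HH Eg.
destruct (binary_products (proj1 hC) B D) as [P [p [q [Hpq Lpq]]]].
destruct (Lpq X f g) as [fg [E1 E2]], (Lpq O i j) as [ij [Ei Ej]].
assert (HH' : is_pullback fg ij h e).
{ apply pullback_intro.
  - apply Hpq; rewrite !comp_assoc, ?E1, ?E2, ?Ei, ?Ej;
      [exact (proj1 HH) | exact Eg].
  - exact (pullback_jointly_monic HH).
  - intros W a b Eab; apply (pullback_lift HH).
    rewrite <- E1, <- Ei, <- !comp_assoc, Eab; reflexivity. }
destruct (proj1 hP X X B f f) as [R [r1 [r2 HR]]].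
destruct (proj1 hP X X P fg fg) as [T [t1 [t2 HT]]].
destruct (initial_map X) as [o _].
destruct (kernel_pair_fibre_exists o HH' HT) as [k [Ek1 Ek2]].
assert (Em : f ∘ t1 = f ∘ t2)
  by (rewrite <- E1, <- !comp_assoc, (proj1 HT); reflexivity).
destruct (pullback_lift HR Em) as [m [Em1 Em2]].
destruct (kernel_pair_diagonal HT) as [d [Ed _]].
assert (Im : is_iso m).
{ apply (@point_iso X T R H t1 d r1 m o k e Ed Em1).
  - exact (kernel_pair_fibre HH' HT Ek1 Ek2).
  - apply (kernel_pair_fibre HH HR); rewrite comp_assoc, ?Em1, ?Em2; assumption. }
destruct Im as [n [_ En]].
intros W a b Eab; destruct (pullback_lift HR Eab) as [c [Ea Eb]].
rewrite <- Ea, <- Eb, <- (comp_idl c), <- En.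
rewrite !comp_assoc, <- (comp_assoc g r1), <- (comp_assoc g r2), Em1, Em2.
rewrite <- E2, <- !(comp_assoc q), (proj1 HT); reflexivity.
Qed.

(* [I ×_T I -> P ×_T I] is a morphism of points over [I] that is invertible on
   fibres over [O]. *)
Lemma monic_iso_of_kernel (I P T N : C) (m : Hom I P) (p : Hom P T)
    (o : Hom O T) (n : Hom N P) (e : Hom N O) (n' : Hom N I) :
  monic m -> is_regular_epi (p ∘ m) -> is_pullback p o n e -> m ∘ n' = n ->
  is_iso m.
Proof.
intros Hm Rpm HN En.
destruct (proj1 hP I I T (p ∘ m) (p ∘ m)) as [K [a1 [a2 HK]]].
destruct (proj1 hP P I T p (p ∘ m)) as [L [b1 [b2 HL]]].
assert (Eg : p ∘ (m ∘ a1) = p ∘ m ∘ a2)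
  by (rewrite comp_assoc; exact (proj1 HK)).
destruct (pullback_lift HL Eg) as [g [Eg1 Eg2]].
destruct (kernel_pair_diagonal HK) as [d [_ Ed]].
destruct (initial_map I) as [z _].
assert (HN' : is_pullback (p ∘ m) o n' e).
{ apply pullback_intro.
  - rewrite <- comp_assoc, En; exact (proj1 HN).
  - intros W a b Ea Eb; apply (pullback_jointly_monic HN); [|exact Eb].
    rewrite <- En, <- !comp_assoc, Ea; reflexivity.
  - intros W a b Eab; rewrite <- comp_assoc in Eab.
    destruct (pullback_lift HN Eab) as [u [Eu1 Eu2]].
    exists u; split; [|exact Eu2].
    apply Hm; crw En; exact Eu1. }
destruct (kernel_pair_fibre_exists z HN' (pullback_sym HK)) as [k [Ek1 Ek2]].
assert (Ig : is_iso g).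
{ apply (@point_iso I K L N a2 d b2 g z k e Ed Eg2).
  - exact (kernel_pair_fibre HN' (pullback_sym HK) Ek1 Ek2).
  - apply pullback_intro.
    + rewrite comp_assoc, Eg2; exact Ek1.
    + intros W a b Ea Eb; apply (pullback_jointly_monic HN'); [|exact Eb].
      apply Hm; rewrite <- Ek2.
      transitivity (b1 ∘ (g ∘ k ∘ a)); [|rewrite Ea];
        rewrite !comp_assoc, Eg1; reflexivity.
    + intros W a b Eab.
      assert (E : p ∘ (b1 ∘ a) = o ∘ b).
      { crw (proj1 HL); rewrite Eab, !comp_assoc; f_equal; apply (initial_eq hO). }
      destruct (pullback_lift HN E) as [u [Eu1 Eu2]].
      exists u; split; [|exact Eu2].
      apply (pullback_jointly_monic HL).
      * crw (comp_eq_r Eg1 (k ∘ u)); crw (comp_eq_r Ek2 u).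
        crw En; exact Eu1.
      * crw (comp_eq_r Eg2 (k ∘ u)); crw Ek1; rewrite Eu2; symmetry; exact Eab. }
destruct Ig as [g' [_ Eg']].
(* [b1] is a pullback of the regular epimorphism [p ∘ m], and inverting [g] factors it through the
   monic [m]. *)
apply (@regular_epi_monic_iso C L I P b1 (a1 ∘ g') m); [|exact Hm|].
- exact (regular_epi_pullback hC (pullback_sym HL) Rpm).
- rewrite comp_assoc, <- Eg1, <- comp_assoc, Eg'; apply comp_idr.
Qed.

(** * Direct images of kernel pairs along regular epimorphisms *)

(** [P] consists of pairs in [T] with a chosen lift of the first component. The image of [phi]
    covers [T] because [rho] does, and it contains the kernel of [p2] by reflexivity of [R]; so it
    is all of [P]. *)
Lemma image_relation_lift (X Y R T P : C) (f : Hom X Y) (r1 r2 : Hom R X)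
    (d : Hom X R) (t1 t2 : Hom T Y) (rho : Hom R T) (p1 : Hom P X) (p2 : Hom P T)
    (phi : Hom R P) :
  r1 ∘ d = idc X -> r2 ∘ d = idc X ->
  jointly_monic t1 t2 -> is_regular_epi rho ->
  t1 ∘ rho = f ∘ r1 -> t2 ∘ rho = f ∘ r2 ->
  is_pullback f t1 p1 p2 -> p1 ∘ phi = r1 -> p2 ∘ phi = rho ->
  is_regular_epi phi.
Proof.
intros Ed1 Ed2 Ht Rrho Er1 Er2 HPb Ep1 Ep2.
destruct (image_factorization hC phi) as [I [q [m [Rq [Hm E]]]]].
destruct (initial_map T) as [o _].
destruct (proj1 hP P O T p2 o) as [N [n [e HN]]].
rewrite <- E; apply (regular_epi_iso Rq).
(* Over [O] the two components of a pair in [T] agree, so the diagonal at [p1 ∘ n] lifts the kernel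
   of [p2] to [R]. *)
apply (@monic_iso_of_kernel I P T N m p2 o n e (q ∘ (d ∘ (p1 ∘ n))) Hm);
  [|exact HN|].
- apply (@regular_epi_cancel C hC R I T q).
  rewrite <- comp_assoc, E, Ep2; exact Rrho.
- rewrite comp_assoc, E; apply (pullback_jointly_monic HPb).
  + crw (comp_eq_r Ep1 (d ∘ (p1 ∘ n))); crw (comp_eq_r Ed1 (p1 ∘ n)); reflexivity.
  + crw (comp_eq_r Ep2 (d ∘ (p1 ∘ n))).
    assert (En : f ∘ (p1 ∘ n) = t2 ∘ (p2 ∘ n)).
    { crw (proj1 HPb); rewrite (proj1 HN), !comp_assoc.
      f_equal; apply (initial_eq hO). }
    apply Ht.
    * crw Er1; crw (comp_eq_r Ed1 (p1 ∘ n)); crw (proj1 HPb); reflexivity.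
    * crw Er2; crw (comp_eq_r Ed2 (p1 ∘ n)); exact En.
Qed.

(** Reflexivity descends along [f] and symmetry along [rho]. For transitivity, composable pairs in
    [T] are lifted, after covers, to composable pairs in [R], composed there and mapped back by
    [rho]. *)
Lemma image_equivalence_relation (X Y B R T : C) (f : Hom X Y) (f1 : Hom X B)
    (r1 r2 : Hom R X) (t1 t2 : Hom T Y) (rho : Hom R T) :
  is_regular_epi f -> is_kernel_pair f1 r1 r2 ->
  jointly_monic t1 t2 -> is_regular_epi rho ->
  t1 ∘ rho = f ∘ r1 -> t2 ∘ rho = f ∘ r2 ->
  is_equivalence_relation t1 t2.
Proof.
intros Rf HR Ht Rrho Er1 Er2.
destruct (kernel_pair_diagonal HR) as [d [Ed1 Ed2]].
split; [exact Ht|split; [|split]].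
- destruct (@regular_epi_factor C X Y T f (rho ∘ d) Rf) as [dT EdT].
  { intros V a b E; apply Ht.
    - crw (comp_eq_rr Er1 (d ∘ a)); crw (comp_eq_r Ed1 a).
      crw (comp_eq_rr Er1 (d ∘ b)); crw (comp_eq_r Ed1 b); exact E.
    - crw (comp_eq_rr Er2 (d ∘ a)); crw (comp_eq_r Ed2 a).
      crw (comp_eq_rr Er2 (d ∘ b)); crw (comp_eq_r Ed2 b); exact E. }
  exists dT; split; apply (regular_epi_epi Rf); crw EdT.
  + crw Er1; crw Ed1; reflexivity.
  + crw Er2; crw Ed2; reflexivity.
- destruct (pullback_lift HR (eq_sym (proj1 HR))) as [s [Es1 Es2]].
  destruct (@regular_epi_factor C R T T rho (rho ∘ s) Rrho) as [sT EsT].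
  { intros V a b E; apply Ht.
    - crw (comp_eq_rr Er1 (s ∘ a)); crw (comp_eq_r Es1 a); crwr Er2.
      crw (comp_eq_rr Er1 (s ∘ b)); crw (comp_eq_r Es1 b); crwr Er2.
      rewrite E; reflexivity.
    - crw (comp_eq_rr Er2 (s ∘ a)); crw (comp_eq_r Es2 a); crwr Er1.
      crw (comp_eq_rr Er2 (s ∘ b)); crw (comp_eq_r Es2 b); crwr Er1.
      rewrite E; reflexivity. }
  exists sT; split; apply (regular_epi_epi Rrho); crw EsT.
  + crw Er1; crw Es1; symmetry; exact Er2.
  + crw Er2; crw Es2; symmetry; exact Er1.
- intros Q q1 q2 HQ.
  destruct (proj1 hP X T Y f t1) as [P [p1 [p2 HPb]]].
  destruct (pullback_lift HPb (eq_sym Er1)) as [phi [Ep1 Ep2]].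
  pose proof (image_relation_lift Ed1 Ed2 Ht Rrho Er1 Er2 HPb Ep1 Ep2) as Rphi.
  destruct (lift_along_regular_epi hC q1 Rrho) as [V [w [r [Rw Er]]]].
  assert (El : f ∘ (r2 ∘ r) = t1 ∘ (q2 ∘ w)).
  { crwr Er2; rewrite Er; crw (proj1 HQ); reflexivity. }
  destruct (pullback_lift HPb El) as [l [El1 El2]].
  (* The second pair is lifted to [r'] starting exactly where the lift [r] of the first one ends. *)
  destruct (lift_along_regular_epi hC l Rphi) as [V' [v [r' [Rv Er']]]].
  assert (E1 : r1 ∘ r' = r2 ∘ (r ∘ v)).
  { rewrite <- Ep1; crw Er'; crw El1; reflexivity. }
  assert (E2 : rho ∘ r' = q2 ∘ (w ∘ v)).
  { rewrite <- Ep2; crw Er'; crw El2; reflexivity. }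
  assert (Ec : f1 ∘ (r1 ∘ (r ∘ v)) = f1 ∘ (r2 ∘ r')).
  { crw (proj1 HR); rewrite <- E1; crw (proj1 HR); reflexivity. }
  destruct (pullback_lift HR Ec) as [c [Ec1 Ec2]].
  assert (F1 : t1 ∘ (rho ∘ c) = t1 ∘ (q1 ∘ (w ∘ v))).
  { crw Er1; rewrite Ec1; crwr Er1; crw (comp_eq_rr Er v); reflexivity. }
  assert (F2 : t2 ∘ (rho ∘ c) = t2 ∘ (q2 ∘ (w ∘ v))).
  { crw Er2; rewrite Ec2; crwr Er2; rewrite E2; reflexivity. }
  pose proof (regular_epi_comp hC Rv Rw) as Rwv.
  (* The composite lives on the cover [V']; joint monicity of [t1], [t2] lets it descend to [Q]. *)
  destruct (@regular_epi_factor C V' Q T (w ∘ v) (rho ∘ c) Rwv) as [t Et].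
  { intros Z a b E; apply Ht.
    - rewrite (comp_eq_r F1 a), (comp_eq_r F1 b), <- !(comp_assoc t1),
        <- !(comp_assoc q1), E; reflexivity.
    - rewrite (comp_eq_r F2 a), (comp_eq_r F2 b), <- !(comp_assoc t2),
        <- !(comp_assoc q2), E; reflexivity. }
  exists t; split; apply (regular_epi_epi Rwv); rewrite <- !comp_assoc, Et;
    assumption.
Qed.

(* [u] is the quotient of [B2] by the image under [f2] of the kernel pair of [f1]. *)
Lemma direct_image_quotient (hE : is_Barr_exact C) (X B1 B2 H : C)
    (f1 : Hom X B1) (f2 : Hom X B2) (i1 : Hom O B1) (h : Hom H X) (e : Hom H O) :
  is_pullback f1 i1 h e -> is_regular_epi f2 ->
  exists (D : C) (u : Hom B2 D),
    (forall (W : C) (a b : Hom W X), f1 ∘ a = f1 ∘ b ->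
       u ∘ f2 ∘ a = u ∘ f2 ∘ b) /\
    (forall (W : C) (g : Hom B2 W),
       (forall (V : C) (a b : Hom V X), f1 ∘ a = f1 ∘ b ->
          g ∘ f2 ∘ a = g ∘ f2 ∘ b) ->
       exists g' : Hom D W, g' ∘ u = g) /\
    (forall (K : C) (j : Hom O D) (k : Hom K B2) (c : Hom K O) (th : Hom H K),
       is_pullback u j k c -> k ∘ th = f2 ∘ h -> c ∘ th = e ->
       is_regular_epi th).
Proof.
intros HH Rf.
destruct (proj1 hP X X B1 f1 f1) as [R [r1 [r2 HR]]].
destruct (binary_products (proj1 hC) B2 B2) as [S [s1 [s2 [Hs Ls]]]].
destruct (Ls R (f2 ∘ r1) (f2 ∘ r2)) as [w [Ew1 Ew2]].
destruct (image_factorization hC w) as [T [rho [m [Rrho [Hm Em]]]]].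
assert (Er1 : s1 ∘ m ∘ rho = f2 ∘ r1) by (crw Em; exact Ew1).
assert (Er2 : s2 ∘ m ∘ rho = f2 ∘ r2) by (crw Em; exact Ew2).
assert (Ht : jointly_monic (s1 ∘ m) (s2 ∘ m)).
{ intros W a b Ea Eb; rewrite <- !comp_assoc in Ea, Eb.
  apply Hm, Hs; assumption. }
set (t1 := s1 ∘ m) in *; set (t2 := s2 ∘ m) in *.
(* Exactness makes [T] a kernel pair, and regularity then provides its coequalizer [u]. *)
destruct (proj2 hE B2 T t1 t2
            (image_equivalence_relation Rf HR Ht Rrho Er1 Er2)) as [D' [g HT]].
destruct (proj1 (proj2 hC) B2 D' T g t1 t2 HT) as [D [u Hu]].
exists D, u; split; [|split].
- intros W a b E; destruct (pullback_lift HR E) as [c [Ea Eb]].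
  rewrite <- Ea, <- Eb, <- !comp_assoc, (comp_assoc f2), (comp_assoc f2 r2).
  rewrite <- Er1, <- Er2, !comp_assoc, (proj1 Hu); reflexivity.
- intros W a Ha.
  destruct (proj2 Hu W a) as [b [Eb _]]; [|exists b; exact Eb].
  apply (regular_epi_epi Rrho); rewrite <- !comp_assoc, Er1, Er2, !comp_assoc.
  apply Ha; exact (proj1 HR).
- intros K j k c th HK Ek Ec.
  (* [g] factors through [u], so [T] is also the kernel pair of its own coequalizer. *)
  assert (HTu : is_kernel_pair u t1 t2).
  { apply pullback_intro; [exact (proj1 Hu)|exact Ht|].
    intros W a b E; apply (pullback_lift HT).
    destruct (proj2 Hu D' g (proj1 HT)) as [v [Ev _]].
    rewrite <- Ev, <- !comp_assoc, E; reflexivity. }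
  destruct (initial_map B2) as [o _], (initial_map X) as [oX _].
  destruct (kernel_pair_fibre_exists o HK HTu) as [ka [Ek1 Ek2]].
  destruct (kernel_pair_fibre_exists oX HH HR) as [kb [El1 El2]].
  destruct (proj1 hP X T B2 f2 t1) as [P [p1 [p2 HPb]]].
  destruct (pullback_lift HPb (eq_sym Er1)) as [phi [Ep1 Ep2]].
  destruct (kernel_pair_diagonal HR) as [d [Ed1 Ed2]].
  assert (El : f2 ∘ (oX ∘ c) = t1 ∘ ka).
  { rewrite Ek1, comp_assoc; f_equal; apply (initial_eq hO). }
  destruct (pullback_lift HPb El) as [la [Ela1 Ela2]].
  (* [la] sends an element of [K] to the pair in [T] from the initial point to it, with [oX] as lift
     of the first component. Lifting this pair to [R] amounts to finding a preimage in [H], so [th]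
     is the pullback of [phi] along [la]. *)
  apply (regular_epi_pullback hC) with (f := phi) (g := la) (p := kb);
    [|exact (image_relation_lift Ed1 Ed2 Ht Rrho Er1 Er2 HPb Ep1 Ep2)].
  apply pullback_intro.
  + apply (pullback_jointly_monic HPb).
    * crw Ep1; crw (comp_eq_r Ela1 th); rewrite Ec; exact El1.
    * crw Ep2; crw (comp_eq_r Ela2 th); apply Ht.
      -- crw Er1; rewrite El1; crw (comp_eq_r Ek1 th); rewrite Ec, comp_assoc.
         f_equal; apply (initial_eq hO).
      -- crw Er2; rewrite El2; crw (comp_eq_r Ek2 th); symmetry; exact Ek.
  + intros W a b Ea Eb; apply (pullback_jointly_monic HH).
    * rewrite <- El2, <- !comp_assoc, Ea; reflexivity.
    * rewrite <- Ec, <- !comp_assoc, Eb; reflexivity.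
  + intros W a b E.
    assert (Ea : r1 ∘ a = oX ∘ (c ∘ b)).
    { rewrite <- Ep1, <- comp_assoc, E; crw (comp_eq_r Ela1 b); reflexivity. }
    assert (Eb : f1 ∘ (r2 ∘ a) = i1 ∘ (c ∘ b)).
    { crwr (proj1 HR); rewrite Ea, (comp_assoc f1).
      f_equal; apply (initial_eq hO). }
    destruct (pullback_lift HH Eb) as [s [Es1 Es2]].
    exists s; split.
    * apply (pullback_jointly_monic HR).
      -- crw (comp_eq_r El1 s); rewrite Es2; symmetry; exact Ea.
      -- crw (comp_eq_r El2 s); exact Es1.
    * apply (pullback_jointly_monic HK); [|crw (comp_eq_r Ec s); exact Es2].
      crw (comp_eq_r Ek s); rewrite Es1; crwr Er2.
      rewrite <- Ep2, <- comp_assoc, E; crw (comp_eq_r Ela2 b).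
      crw (comp_eq_r Ek2 b); reflexivity.
Qed.

(** * Order, meets and quotients of normal spans *)

Section Spans.
Variable X : C.
Implicit Types H K M J : Span O X.

Lemma kernel_jointly_monic (B : C) (f : Hom X B) H :
  is_kernel f H -> jointly_monic (span_h H) (span_e H).
Proof. intros [i Hi]; exact (pullback_jointly_monic Hi). Qed.

Lemma kernel_eq (B : C) (f : Hom X B) H (j : Hom O B) :
  is_kernel f H -> f ∘ span_h H = j ∘ span_e H.
Proof.
intros [i Hi]; rewrite (proj1 Hi); f_equal; apply (initial_eq hO).
Qed.

Lemma span_le_kernel (B : C) (f : Hom X B) (i : Hom O B) H K :
  is_kernel f K -> (span_le H K <-> f ∘ span_h H = i ∘ span_e H).
Proof.
intros HK; split.
- intros [eta [E1 E2]]; rewrite <- E1, <- E2, !comp_assoc.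
  f_equal; exact (kernel_eq i HK).
- intros E; destruct HK as [j Hj]; rewrite (initial_eq hO i j) in E.
  destruct (pullback_lift Hj E) as [eta [E1 E2]]; exists eta; split; assumption.
Qed.

Lemma span_le_trans H K M : span_le H K -> span_le K M -> span_le H M.
Proof.
intros [a [Ea1 Ea2]] [b [Eb1 Eb2]]; exists (b ∘ a); split.
- crw Eb1; exact Ea1.
- crw Eb2; exact Ea2.
Qed.

(** Joins are determined only up to mutual inequality; this transfers the kernel property from a
    constructed join to any other. *)
Lemma kernel_antisym (B : C) (f : Hom X B) H K :
  is_kernel f H -> is_normal K -> span_le H K -> span_le K H -> is_kernel f K.
Proof.
intros HH [D [g HK]] [a [Ea1 Ea2]] HKH.
destruct (initial_map B) as [i _]; exists i; apply pullback_intro.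
- exact (proj1 (span_le_kernel i K HH) HKH).
- exact (kernel_jointly_monic HK).
- intros W x z E; destruct HH as [j Hj]; rewrite (initial_eq hO i j) in E.
  destruct (pullback_lift Hj E) as [w [E1 E2]]; exists (a ∘ w); split.
  + crw (comp_eq_r Ea2 w); exact E1.
  + crw (comp_eq_r Ea1 w); exact E2.
Qed.

(** The monic part of the image factorization of [f] does not affect the kernel. *)
Lemma normal_regular_kernel H : is_normal H ->
  exists (B : C) (f : Hom X B), is_regular_epi f /\ is_kernel f H.
Proof.
intros [B [f Hf]].
destruct (image_factorization hC f) as [Q [q [m [Rq [Hm E]]]]].
exists Q, q; split; [exact Rq|].
destruct (initial_map Q) as [z _]; exists z; apply pullback_intro.
- apply Hm; rewrite !comp_assoc, E; exact (kernel_eq (m ∘ z) Hf).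
- exact (kernel_jointly_monic Hf).
- intros W a b Eab; destruct Hf as [i Hi]; apply (pullback_lift Hi).
  rewrite <- E, (initial_eq hO i (m ∘ z)), <- !comp_assoc, Eab; reflexivity.
Qed.

(** By [coequalizes_of_kernel], a morphism compatible with the kernel span identifies all that [q]
    identifies, hence factors through [q]. *)
Lemma quotient_of_regular_kernel (Q : C) (q : Hom X Q) H :
  is_regular_epi q -> is_kernel q H -> is_quotient H Q.
Proof.
intros Rq [z Hz]; exists z, q; split; [symmetry; exact (proj1 Hz)|].
intros W a b E.
destruct (@regular_epi_factor C X Q W q b Rq) as [u Eu].
{ exact (coequalizes_of_kernel Hz (eq_sym E)). }
exists u; split.
- split; [apply (initial_eq hO)|exact Eu].
- intros v [_ Ev]; apply (regular_epi_epi Rq); congruence.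
Qed.

(** The meet is the kernel of the pairing of [f1] and [f2]. The second clause gives lifts from
    arbitrary spans, not only normal ones, as pullback arguments require. *)
Lemma meet_exists (B1 B2 : C) (f1 : Hom X B1) (f2 : Hom X B2) H1 H2 :
  is_kernel f1 H1 -> is_kernel f2 H2 ->
  exists M, is_meet H1 H2 M /\
    forall (W : C) (a : Hom W X) (z : Hom W O) (i1 : Hom O B1) (i2 : Hom O B2),
      f1 ∘ a = i1 ∘ z -> f2 ∘ a = i2 ∘ z ->
      exists u : Hom W (apex M), span_h M ∘ u = a /\ span_e M ∘ u = z.
Proof.
intros HH1 HH2.
destruct (binary_products (proj1 hC) B1 B2) as [P [p [q [Hpq Lpq]]]].
destruct (Lpq X f1 f2) as [g [E1 E2]].
destruct (initial_map P) as [o _].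
destruct (proj1 hP X O P g o) as [N [h [e HN]]].
pose (M := {| apex := N; span_e := e; span_h := h |}).
assert (L : forall (W : C) (a : Hom W X) (z : Hom W O) (i1 : Hom O B1)
  (i2 : Hom O B2), f1 ∘ a = i1 ∘ z -> f2 ∘ a = i2 ∘ z ->
  exists u : Hom W (apex M), span_h M ∘ u = a /\ span_e M ∘ u = z).
{ intros W a z i1 i2 Ea1 Ea2; apply (pullback_lift HN), Hpq.
  - rewrite !comp_assoc, E1, Ea1; f_equal; apply (initial_eq hO).
  - rewrite !comp_assoc, E2, Ea2; f_equal; apply (initial_eq hO). }
exists M; split; [|exact L].
split; [exists P, g, o; exact HN|split; [|split]].
- apply (span_le_kernel (p ∘ o) M HH1); simpl.
  rewrite <- E1, <- !comp_assoc, (proj1 HN); reflexivity.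
- apply (span_le_kernel (q ∘ o) M HH2); simpl.
  rewrite <- E2, <- !comp_assoc, (proj1 HN); reflexivity.
- intros H _ L1 L2.
  pose proof (proj1 (span_le_kernel (p ∘ o) H HH1) L1) as F1.
  pose proof (proj1 (span_le_kernel (q ∘ o) H HH2) L2) as F2.
  destruct (L _ _ _ _ _ F1 F2) as [u [Eu1 Eu2]].
  exists u; split; assumption.
Qed.

(** Any meet dominates the constructed one, and so inherits its lifting property. *)
Lemma meet_lift (B1 B2 : C) (f1 : Hom X B1) (f2 : Hom X B2) H1 H2 M :
  is_kernel f1 H1 -> is_kernel f2 H2 -> is_meet H1 H2 M ->
  forall (W : C) (a : Hom W X) (z : Hom W O) (i1 : Hom O B1) (i2 : Hom O B2),
    f1 ∘ a = i1 ∘ z -> f2 ∘ a = i2 ∘ z ->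
    exists u : Hom W (apex M), span_h M ∘ u = a /\ span_e M ∘ u = z.
Proof.
intros HH1 HH2 HM W a z i1 i2 E1 E2.
destruct (meet_exists HH1 HH2) as [M0 [HM0 L]].
destruct (proj2 (proj2 (proj2 HM)) M0 (proj1 HM0) (proj1 (proj2 HM0))
            (proj1 (proj2 (proj2 HM0)))) as [v [Ev1 Ev2]].
destruct (L W a z i1 i2 E1 E2) as [u [Eu1 Eu2]]; exists (v ∘ u); split.
- crw (comp_eq_r Ev2 u); exact Eu1.
- crw (comp_eq_r Ev1 u); exact Eu2.
Qed.

(** [th] is [f] restricted to [K]. Only joint monicity is asked of [K0], so that it can be the
    product of [B] and [O] or the kernel of a morphism out of [B]. The leg [c] records the map to
    [O], since [O] need not be terminal. *)
Lemma kernel_span_over (B K0 : C) (f : Hom X B) (i : Hom O B) H K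
    (eta : Hom (apex H) (apex K)) (k : Hom K0 B) (c : Hom K0 O)
    (th : Hom (apex K) K0) :
  le_via eta -> jointly_monic (span_h K) (span_e K) -> jointly_monic k c ->
  jointly_monic (span_h H) (span_e H) ->
  k ∘ th = f ∘ span_h K -> c ∘ th = span_e K ->
  f ∘ span_h H = i ∘ span_e H ->
  (forall (W : C) (a : Hom W (apex K)),
     f ∘ (span_h K ∘ a) = i ∘ (span_e K ∘ a) ->
     exists b : Hom W (apex H),
       span_h H ∘ b = span_h K ∘ a /\ span_e H ∘ b = span_e K ∘ a) ->
  is_kernel th (span_over eta).
Proof.
intros [Ee Eh] JK Jk JH Ek Ec EH L.
destruct (initial_map K0) as [j _].
assert (Ecj : c ∘ j = idc O) by apply (initial_eq hO).
assert (Ekj : k ∘ j = i) by apply (initial_eq hO).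
exists j; simpl; apply pullback_intro.
- apply Jk.
  + crw (comp_eq_r Ek eta); crw Eh; rewrite (comp_assoc k), Ekj; exact EH.
  + crw (comp_eq_r Ec eta); rewrite (comp_assoc c), Ecj, comp_idl; exact Ee.
- intros W a b Ea Eb; apply JH; [|exact Eb].
  rewrite <- Eh, <- !comp_assoc, Ea; reflexivity.
- intros W a z E.
  assert (Ez : span_e K ∘ a = z).
  { rewrite <- Ec, <- comp_assoc, E; crw (comp_eq_r Ecj z); reflexivity. }
  destruct (L W a) as [b [Eb1 Eb2]].
  { rewrite Ez, <- Ekj, <- comp_assoc, <- E; crw (comp_eq_r Ek a); reflexivity. }
  exists b; split.
  + apply JK; [crw (comp_eq_r Eh b); exact Eb1|crw (comp_eq_r Ee b); exact Eb2].
  + rewrite Eb2; exact Ez.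
Qed.

(** [H] is the kernel of [f ∘ span_h K] paired with [span_e K]; the second component forces the legs
    to [O] to agree. *)
Lemma normal_over_of_le H K :
  is_normal H -> is_normal K -> span_le H K -> is_normal_over H K.
Proof.
intros [B [f Hf]] [D [g Hg]] [eta Heta].
exists eta; split; [exact Heta|].
destruct (binary_products (proj1 hC) B O) as [P [p [q [Hpq Lpq]]]].
destruct (Lpq (apex K) (f ∘ span_h K) (span_e K)) as [th [E1 E2]].
destruct (initial_map B) as [i _].
exists P, th.
apply (@kernel_span_over B P f i H K eta p q th Heta
  (kernel_jointly_monic Hg) Hpq (kernel_jointly_monic Hf) E1 E2 (kernel_eq i Hf)).
intros W a E; destruct Hf as [j Hj]; rewrite (initial_eq hO i j) in E.
exact (pullback_lift Hj E).
Qed.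

End Spans.

(** * The join and the common quotient in a protomodular exact category *)

Theorem second_isomorphism (hE : is_Barr_exact C) (X : C) (H1 H2 : Span O X) :
  is_normal H1 -> is_normal H2 ->
  (exists M : Span O X, is_meet H1 H2 M) /\
  (exists J : Span O X, is_join H1 H2 J) /\
  (forall M J : Span O X, is_meet H1 H2 M -> is_join H1 H2 J ->
     (is_normal_over M H1 /\ is_normal_over M H2 /\ is_normal_over M J) /\
     (is_normal_over H1 J /\ is_normal_over H2 J) /\
     (forall (eta1 : Hom (apex M) (apex H1)) (eta2 : Hom (apex H2) (apex J)),
        le_via eta1 -> le_via eta2 ->
        exists Q : C,
          is_quotient (span_over eta1) Q /\ is_quotient (span_over eta2) Q)).
Proof.
intros hH1 hH2.
destruct (normal_regular_kernel hH1) as [B1 [f1 [Rf1 HH1]]].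
destruct (normal_regular_kernel hH2) as [B2 [f2 [Rf2 HH2]]].
destruct HH1 as [i1 Hi1].
destruct (direct_image_quotient hE Hi1 Rf2) as [D [u [Du1 [Du2 Du3]]]].
assert (HH1 : is_kernel f1 H1) by (exists i1; exact Hi1).
destruct (initial_map D) as [j _], (initial_map B2) as [i2 _].
destruct (proj1 hP X O D (u ∘ f2) j) as [N [hJ [eJ HN]]].
pose (J0 := {| apex := N; span_e := eJ; span_h := hJ |}).
assert (KJ0 : is_kernel (u ∘ f2) J0) by (exists j; exact HN).
assert (HJ0 : is_join H1 H2 J0).
{ split; [exists D, (u ∘ f2); exact KJ0|split; [|split]].
  - apply (span_le_kernel j H1 KJ0).
    destruct (@regular_epi_factor C X B1 D f1 (u ∘ f2) Rf1 Du1) as [v Ev].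
    rewrite <- Ev, <- comp_assoc, (proj1 Hi1), comp_assoc.
    f_equal; apply (initial_eq hO).
  - apply (span_le_kernel j H2 KJ0).
    rewrite <- comp_assoc, (kernel_eq i2 HH2), comp_assoc.
    f_equal; apply (initial_eq hO).
  - intros H [W [g Hg]] L1 L2; destruct (initial_map W) as [k _].
    pose proof (proj1 (span_le_kernel k H1 Hg) L1) as G1.
    pose proof (proj1 (span_le_kernel k H2 Hg) L2) as G2.
    destruct HH2 as [i2' Hi2].
    (* A morphism [g] with kernel above [H2] factors through [f2]; as its kernel is also above [H1],
       the factor [g'] descends along [u]. *)
    destruct (@regular_epi_factor C X B2 W f2 g Rf2) as [g' Eg'].
    { exact (coequalizes_of_kernel Hi2 G2). }
    destruct (Du2 W g') as [g'' Eg''].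
    { intros V a b Eab; rewrite Eg'.
      exact (coequalizes_of_kernel Hi1 G1 Eab). }
    apply (span_le_kernel k J0 Hg).
    rewrite <- Eg', <- Eg'', <- (comp_assoc g''), <- comp_assoc.
    rewrite (kernel_eq j KJ0), comp_assoc; f_equal; apply (initial_eq hO). }
split; [destruct (meet_exists HH1 HH2) as [M [HM _]]; exists M; exact HM|].
split; [exists J0; exact HJ0|].
intros M J HM HJ.
pose proof HM as [NM [LM1 [LM2 _]]].
pose proof HJ as [NJ [LJ1 [LJ2 LJ]]].
split; [|split].
- split; [|split]; apply normal_over_of_le; trivial.
  exact (span_le_trans LM1 LJ1).
- split; apply normal_over_of_le; assumption.
- intros eta1 eta2 He1 He2.
  assert (KJ : is_kernel (u ∘ f2) J).
  { destruct HJ0 as [NJ0 [L01 [L02 L0]]].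
    apply (kernel_antisym KJ0 NJ); [apply L0|apply LJ]; assumption. }
  (* The kernel [K] of [u] is the common quotient: [f2] restricts to [th] on [H1] and to [thJ] on
     [J]. *)
  destruct (proj1 hP B2 O D u j) as [K [k [c HK]]].
  assert (E1 : u ∘ (f2 ∘ span_h H1) = j ∘ span_e H1).
  { rewrite comp_assoc; exact (proj1 (span_le_kernel j H1 KJ) LJ1). }
  assert (EJ : u ∘ (f2 ∘ span_h J) = j ∘ span_e J).
  { rewrite comp_assoc; exact (kernel_eq j KJ). }
  destruct (pullback_lift HK E1) as [th [Eth1 Eth2]].
  destruct (pullback_lift HK EJ) as [thJ [EthJ1 EthJ2]].
  exists K; split.
  + apply quotient_of_regular_kernel with (q := th);
      [exact (Du3 K j k c th HK Eth1 Eth2)|].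
    destruct NM as [Z [g Hg]].
    apply (@kernel_span_over X B2 K f2 i2 M H1 eta1 k c th He1
      (kernel_jointly_monic HH1) (pullback_jointly_monic HK)
      (kernel_jointly_monic Hg) Eth1 Eth2 (proj1 (span_le_kernel i2 M HH2) LM2)).
    intros W a Ea; apply (meet_lift HH1 HH2 HM (i1 := i1) (i2 := i2));
      [|exact Ea].
    crw (comp_eq_rr (proj1 Hi1) a); reflexivity.
  + apply quotient_of_regular_kernel with (q := thJ).
    (* [J] is the inverse image of [K] along [f2], so [thJ] is a pullback of [f2]. *)
    * apply (regular_epi_pullback hC) with (f := f2) (g := k) (p := span_h J);
        [|exact Rf2].
      apply pullback_intro; [symmetry; exact EthJ1| |].
      -- intros W a b Ea Eb; apply (kernel_jointly_monic KJ); [exact Ea|].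
         rewrite <- EthJ2, <- !comp_assoc, Eb; reflexivity.
      -- intros W a b Eab.
         assert (E : u ∘ f2 ∘ a = j ∘ (c ∘ b)).
         { rewrite <- comp_assoc, Eab; crw (proj1 HK); reflexivity. }
         destruct KJ as [j' Hj']; rewrite (initial_eq hO j j') in E.
         destruct (pullback_lift Hj' E) as [w [Ew1 Ew2]].
         exists w; split; [exact Ew1|].
         apply (pullback_jointly_monic HK).
         ++ crw (comp_eq_r EthJ1 w); rewrite Ew1; exact Eab.
         ++ crw (comp_eq_r EthJ2 w); exact Ew2.
    * apply (@kernel_span_over X B2 K f2 i2 H2 J eta2 k c thJ He2
        (kernel_jointly_monic KJ) (pullback_jointly_monic HK)
        (kernel_jointly_monic HH2) EthJ1 EthJ2 (kernel_eq i2 HH2)).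
      intros W a Ea; destruct HH2 as [i2' Hi2].
      rewrite (initial_eq hO i2 i2') in Ea; exact (pullback_lift Hi2 Ea).
Qed.

End Protomodular.

(** * Transfer of protomodularity along a monadic functor *)

Lemma right_adjoint_pullback (C D : Category) (F : Functor C D) (U : Functor D C)
    (adj : Adjunction F U) (X Y B P : D) (f : Hom X B) (g : Hom Y B)
    (p : Hom P X) (q : Hom P Y) :
  is_pullback f g p q ->
  is_pullback (fmap U f) (fmap U g) (fmap U p) (fmap U q).
Proof.
intros Hp.
(* [tr] is the adjoint transpose; being natural and bijective, it carries the lifting problem over
   to [D]. *)
pose (tr := fun (W : C) (Z : D) (a : Hom W (U Z)) => counit adj Z ∘ fmap F a).
assert (tr_comp : forall W Z Z' (h : Hom Z Z') (a : Hom W (U Z)),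
  tr W Z' (fmap U h ∘ a) = h ∘ tr W Z a).
{ intros W Z Z' h a; unfold tr; rewrite fmap_comp, !comp_assoc; f_equal.
  symmetry; exact (naturality (counit adj) h). }
assert (tr_inv : forall W Z (b : Hom (F W) Z),
  tr W Z (fmap U b ∘ unit adj W) = b).
{ intros W Z b; rewrite tr_comp; unfold tr.
  exact (eq_trans (f_equal (comp b) (triangle_left adj W)) (comp_idr b)). }
assert (inv_tr : forall W Z (a : Hom W (U Z)),
  fmap U (tr W Z a) ∘ unit adj W = a).
{ intros W Z a; unfold tr; rewrite fmap_comp, <- comp_assoc.
  transitivity (fmap U (counit adj Z) ∘ (unit adj (U Z) ∘ a)).
  - f_equal; exact (naturality (unit adj) a).
  - exact (eq_trans (comp_eq_r (triangle_right adj Z) a) (comp_idl a)). }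
assert (tr_inj : forall W Z (a b : Hom W (U Z)), tr W Z a = tr W Z b -> a = b).
{ intros W Z a b E; rewrite <- (inv_tr W Z a), E; apply inv_tr. }
apply pullback_intro.
- rewrite <- !fmap_comp, (proj1 Hp); reflexivity.
- intros W a b Ea Eb; apply tr_inj, (pullback_jointly_monic Hp);
    rewrite <- !tr_comp; congruence.
- intros W a b E.
  assert (E' : f ∘ tr W X a = g ∘ tr W Y b) by (rewrite <- !tr_comp, E; reflexivity).
  destruct (pullback_lift Hp E') as [v [Ev1 Ev2]].
  exists (fmap U v ∘ unit adj W).
  split; apply tr_inj; rewrite tr_comp, tr_inv; assumption.
Qed.

Lemma functor_iso (C D : Category) (F : Functor C D) (X Y : C) (f : Hom X Y) :
  is_iso f -> is_iso (fmap F f).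
Proof.
intros [g [E1 E2]]; exists (fmap F g).
rewrite <- !fmap_comp, E1, E2, !fmap_id; split; reflexivity.
Qed.

Lemma iso_conjugate (C : Category) (X Y X' Y' : C) (f : Hom X Y)
    (h : Hom X' Y') (a : Hom X' X) (b : Hom Y' Y) :
  is_iso a -> is_iso b -> is_iso h -> f ∘ a = b ∘ h -> is_iso f.
Proof.
intros [a' [Ea1 Ea2]] [b' [Eb1 Eb2]] [h' [Eh1 Eh2]] E.
exists (a ∘ h' ∘ b'); split.
- transitivity (a ∘ h' ∘ b' ∘ (f ∘ a) ∘ a').
  + crw Ea2; reflexivity.
  + rewrite E; crw (comp_eq_r Eb1 (h ∘ a')); crw (comp_eq_r Eh1 a'); exact Ea2.
- crw (comp_eq_rr E (h' ∘ b')); crw (comp_eq_r Eh2 b'); exact Eb2.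
Qed.

Lemma equivalence_reflects_iso (C D : Category) (F : Functor C D) (X Y : C)
    (f : Hom X Y) : is_equivalence F -> is_iso (fmap F f) -> is_iso f.
Proof.
intros [G [[t Ht] _]] If.
exact (iso_conjugate (Ht X) (Ht Y) (functor_iso G If) (naturality t f)).
Qed.

(** The inverse of the underlying morphism automatically commutes with the actions. *)
Lemma algebra_iso (C : Category) (T : Monad C) (X Y : Algebra T)
    (f : AlgebraHom X Y) :
  is_iso (alg_map f) -> is_iso (f : @Hom (EilenbergMoore T) X Y).
Proof.
intros [g [E1 E2]].
assert (Hg : g ∘ action Y = action X ∘ fmap T g).
{ rewrite <- (comp_idr (g ∘ action Y)), <- (fmap_id T), <- E2, fmap_comp.
  crwr (alg_map_action f); crw (comp_eq_r E1 (action X ∘ fmap T g)).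
  reflexivity. }
exists (Build_AlgebraHom Hg); split; apply AlgebraHom_eq; assumption.
Qed.

(** [U] preserves pullbacks as a right adjoint. It reflects isomorphisms, being the comparison
    equivalence followed by the forgetful functor. Hence the whole diagram of points can be tested
    in [C]. *)
Lemma monadic_protomodular (C D : Category) (U : Functor D C) :
  monadic U -> has_pullbacks D -> is_protomodular C -> is_protomodular D.
Proof.
intros [F [adj He]] hD [_ hP]; split; [exact hD|].
intros E B p X x s Y y t g XE pX xE sE YE pY yE tE gE
  Es Et Eg Egs PX E1 E2 PY E3 E4 E5 E6 Ig.
apply (equivalence_reflects_iso He), algebra_iso; simpl.
apply (hP (U E) (U B) (fmap U p) (U X) (fmap U x) (fmap U s)
  (U Y) (fmap U y) (fmap U t) (fmap U g) (U XE) (fmap U pX) (fmap U xE)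
  (fmap U sE) (U YE) (fmap U pY) (fmap U yE) (fmap U tE) (fmap U gE));
  try (rewrite <- !fmap_comp, <- ?fmap_id; f_equal; assumption).
- exact (right_adjoint_pullback adj PX).
- exact (right_adjoint_pullback adj PY).
- exact (functor_iso U Ig).
Qed.

(** * The isomorphism theorem for ideally exact categories *)

Theorem theorem5p18 (A : Category) (hA : is_ideally_exact A)
    (O : A) (hO : is_initial O)
    (X : A) (H1 H2 : Span O X) (hH1 : is_normal H1) (hH2 : is_normal H2) :
  (exists M : Span O X, is_meet H1 H2 M) /\
  (exists J : Span O X, is_join H1 H2 J) /\
  (forall M J : Span O X, is_meet H1 H2 M -> is_join H1 H2 J ->
     (is_normal_over M H1 /\ is_normal_over M H2 /\ is_normal_over M J) /\
     (is_normal_over H1 J /\ is_normal_over H2 J) /\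
     (forall (eta1 : Hom (apex M) (apex H1)) (eta2 : Hom (apex H2) (apex J)),
        le_via eta1 -> le_via eta2 ->
        exists Q1 Q2 : A,
          is_quotient (span_over eta1) Q1 /\
          is_quotient (span_over eta2) Q2 /\
          isomorphic Q1 Q2)).
Proof.
destruct hA as [hE [_ [V [U [hV hU]]]]].
pose proof (monadic_protomodular hU (proj2 (proj1 (proj1 hE)))
              (proj1 (proj2 (proj2 hV)))) as hP.
destruct (second_isomorphism hO (proj1 hE) hP hE hH1 hH2) as [hM [hJ hMJ]].
split; [exact hM|split; [exact hJ|]].
intros M J HM HJ; destruct (hMJ M J HM HJ) as [N1 [N2 N3]].
split; [exact N1|split; [exact N2|]].
intros eta1 eta2 He1 He2; destruct (N3 eta1 eta2 He1 He2) as [Q [HQ1 HQ2]].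
(* One object serves as both pushouts, so the isomorphism is an identity. *)
exists Q, Q; split; [exact HQ1|split; [exact HQ2|]].
exists (idc Q), (idc Q); split; apply comp_idl.
Qed.
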